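(* Let $P$ be a definite logic program, $\leftarrow Q$ a query ($Q$ a conjunction of atoms), $J$ a pre-interpretation of $P$ with domain $D$, and $I$ an interpretation of $P$ based on $J$. Let $I^a = I \cup I_J$ be the corresponding interpretation of $P^a \cup P^a_J$. Then $I$ is a model of $P \cup \{\mathit{false}\leftarrow Q\}$ if and only if $I^a$ is a model of $P^a \cup P^a_J \cup \{\mathit{false}\leftarrow Q^a\}$.
   Context: A pre-interpretation $J$ of $P$ consists of a domain $D$ and for each functor $f/n$ of $P$ a map $f_J:D^n\to D$; an interpretation $I$ based on $J$ additionally assigns to each predicate $p/n$ a map $D^n\to\{\mathit{true},\mathit{false}\}$, and is identified with the set of atoms $p(d_1,\dots,d_n)$, $d_i\in D$, that are true. Abstract compilation: in a clause (or query), repeatedly replace a non-variable term $f(t_1,\dots,t_n)$ occurring in it by a fresh variable $X$ and add the atom $p_f(t_1,\dots,t_n,X)$ to the body, where $p_f/(n+1)$ is a new predicate symbol associated with $f/n$ (for a constant $a$ this adds $p_a(X)$), until no non-variable terms remain. $Cl^a$ denotes the result for a clause $Cl$, $P^a$ the set of abstracted clauses of $P$, and $Q^a$ the abstracted query body. $P^a_J$ is the set of facts $\{p_f(d_1,\dots,d_n,d)\leftarrow \;:\; f_J(d_1,\dots,d_n)=d\}$ (the relational form of $J$). The program $P^a\cup P^a_J$ has as its only function symbols the elements of $D$ (as constants), so its Herbrand pre-interpretation has domain $D$. $I_J$ is the least Herbrand model of $P^a_J$ (the set of those facts), and $I^a = I\cup I_J$ is the Herbrand interpretation of $P^a\cup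 P^a_J$ in which the program predicates are interpreted as in $I$ and each $p_f$ as the graph of $f_J$. *)

(* Defs.v *)
From mathcomp Require Import all_boot.
From mathcomp Require Import classical_sets.
From Stdlib Require List.
From Stdlib Require Import Relations.

Set Implicit Arguments.
Unset Strict Implicit.
Unset Printing Implicit Defensive.

Local Open Scope classical_set_scope.

Record ranked := Ranked { symbol :> Type; arity : symbol -> nat }.

Inductive term (F : ranked) : Type :=
| Var of nat
| App (f : F) of (term F ^ arity f)%type.
Arguments Var {F} _.
Arguments App {F} f _.

Fixpoint vars (F : ranked) (t : term F) : seq nat :=
  match t with
  | Var x => [:: x]
  | App f ts => flatten (codom (fun i => vars (ts i)))
  end.

Fixpoint subst (F : ranked) (X : nat) (u t : term F) : term F :=
  match t with
  | Var x => if x == X then u else Var x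
  | App f ts => App f [ffun i => subst X u (ts i)]
  end.

(* Atoms and clauses are parametric in the type [T] of arguments: [term F]
   for syntax, [nat] (variables) for syntax without function symbols, and the
   domain [D] for the atoms p(d1, ..., dn) of an interpretation. *)
Record atom (R : ranked) (T : Type) := Atom {
  pred_of : R;
  args : (T ^ arity pred_of)%type
}.

Definition map_atom (R : ranked) (T U : Type) (g : T -> U) (a : atom R T) :
  atom R U := Atom [ffun i => g (args a i)].

(* The head [None] stands for the logical constant false. *)
Record clause (R : ranked) (T : Type) := Clause {
  chead : option (atom R T);
  cbody : seq (atom R T)
}.

Definition map_clause (R S : ranked) (T U : Type) (g : atom R T -> atom S U)
  (C : clause R T) : clause S U :=
  Clause (omap g (chead C)) (map g (cbody C)).

Definition false_if (R : ranked) (T : Type) (Q : seq (atom R T)) : clause R T :=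
  Clause None Q.

Definition definite (R : ranked) (T : Type) (P : set (clause R T)) : Prop :=
  forall C, P C -> chead C <> None.

Definition clause_vars (R F : ranked) (C : clause R (term F)) : seq nat :=
  flatten [seq flatten (codom (fun i => vars (args a i)))
          | a <- seq_of_opt (chead C) ++ cbody C].

Definition subst_clause (R F : ranked) (X : nat) (u : term F) :
  clause R (term F) -> clause R (term F) :=
  map_clause (map_atom (subst X u)).

Definition pre_interpretation (F : ranked) (D : Type) : Type :=
  forall f : F, (D ^ arity f)%type -> D.

Fixpoint eval (F : ranked) (D : Type) (J : pre_interpretation F D)
  (v : nat -> D) (t : term F) : D :=
  match t with
  | Var x => v x
  | App f ts => J f [ffun i => eval J v (ts i)]
  end.

Definition interpretation (R : ranked) (D : Type) : Type := set (atom R D).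

Definition clause_holds (R F : ranked) (D : Type) (J : pre_interpretation F D)
  (I : interpretation R D) (C : clause R (term F)) : Prop :=
  forall v : nat -> D,
    (forall a, List.In a (cbody C) -> I (map_atom (eval J v) a)) ->
    if chead C is Some a then I (map_atom (eval J v) a) else False.

Definition model (R F : ranked) (D : Type) (J : pre_interpretation F D)
  (I : interpretation R D) (P : set (clause R (term F))) : Prop :=
  forall C, P C -> clause_holds J I C.

Definition snoc (T : Type) (n : nat) (ts : (T ^ n)%type) (x : T) :
  (T ^ n.+1)%type := [ffun i => oapp ts x (unlift ord_max i)].

(* [inr f] is the predicate symbol p_f. *)
Definition abs_preds (R F : ranked) : ranked :=
  @Ranked (R + F) (fun s => match s with
                            | inl p => arity p
                            | inr f => (arity f).+1
                            end).

Definition prog_atom (R F : ranked) (T : Type) (a : atom R T) :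
  atom (abs_preds R F) T := @Atom (abs_preds R F) T (inl (pred_of a)) (args a).

Definition graph_atom (R F : ranked) (T : Type) (f : F)
  (ts : (T ^ arity f)%type) (x : T) : atom (abs_preds R F) T :=
  @Atom (abs_preds R F) T (inr f) (snoc ts x).

(* [C0] is the clause [C] in which X replaces one or more occurrences of
   f(ts): X does not occur in [C], and putting f(ts) back for X in [C0] gives
   [C]. Hence replacing a single occurrence, or all of them, are both steps. *)
Inductive abstract_step (R F : ranked) (C : clause (abs_preds R F) (term F)) :
  clause (abs_preds R F) (term F) -> Prop :=
| AbstractStep (C0 : clause (abs_preds R F) (term F)) (X : nat) (f : F)
    (ts : (term F ^ arity f)%type) of
    X \notin clause_vars C & X \in clause_vars C0 &
    C = subst_clause X (App f ts) C0 :
    abstract_step C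
      (Clause (chead C0) (rcons (cbody C0) (graph_atom R ts (Var X)))).

Definition of_vars (R F : ranked) : clause R nat -> clause R (term F) :=
  map_clause (map_atom Var).

(* The target [Ca] has variables as its only arguments, so the steps are
   carried on until no non-variable term remains. *)
Definition abstracts_to (R F : ranked) (C : clause R (term F))
  (Ca : clause (abs_preds R F) nat) : Prop :=
  clos_refl_trans _ (@abstract_step R F)
    (map_clause (@prog_atom R F (term F)) C) (of_vars F Ca).

(* The result of abstract compilation depends on the order of the steps and on
   the fresh variables; [cl_a] is any function that selects a result Cl^a for
   each clause Cl. *)
Definition abstract_compilation (R F : ranked)
  (cl_a : clause R (term F) -> clause (abs_preds R F) nat) : Prop :=
  forall C, abstracts_to C (cl_a C).

Definition constants (D : Type) : ranked := @Ranked D (fun=> 0).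

Definition const (D : Type) (d : D) : term (constants D) :=
  @App (constants D) d (ffun0 (card_ord 0)).

(* The Herbrand universe of [constants D] is identified with [D]. *)
Definition herbrand (D : Type) : pre_interpretation (constants D) D :=
  fun d _ => d.
Arguments herbrand D : clear implicits.

Definition abs_program (R F : ranked) (D : Type)
  (cl_a : clause R (term F) -> clause (abs_preds R F) nat)
  (P : set (clause R (term F))) :
  set (clause (abs_preds R F) (term (constants D))) :=
  [set of_vars (constants D) (cl_a C) | C in P].
Arguments abs_program {R F} D cl_a P.

Definition abs_query (R F : ranked) (D : Type)
  (cl_a : clause R (term F) -> clause (abs_preds R F) nat)
  (Q : seq (atom R (term F))) :
  seq (atom (abs_preds R F) (term (constants D))) :=
  cbody (of_vars (constants D) (cl_a (false_if Q))).
Arguments abs_query {R F} D cl_a Q.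

Definition facts_of (R F : ranked) (D : Type) (J : pre_interpretation F D) :
  set (clause (abs_preds R F) (term (constants D))) :=
  [set C | exists f (ds : (D ^ arity f)%type) (d : D), J f ds = d /\
    C = Clause (Some (map_atom (@const D) (graph_atom R ds d))) [::]].
Arguments facts_of R {F D} J.

Definition least_herbrand_model (R : ranked) (D : Type)
  (P : set (clause R (term (constants D)))) : interpretation R D :=
  \bigcap_(M in [set M | model (herbrand D) M P]) M.

Definition abs_interpretation (R F : ranked) (D : Type)
  (J : pre_interpretation F D) (I : interpretation R D) :
  interpretation (abs_preds R F) D :=
  (@prog_atom R F D @` I) `|` least_herbrand_model (facts_of R J).

(* Main.v *)
Require Import Defs.
From mathcomp Require Import all_boot.
From mathcomp Require Import classical_sets.
From Stdlib Require List.
From Stdlib Require Import Relations.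

Set Implicit Arguments.
Unset Strict Implicit.
Unset Printing Implicit Defensive.

Local Open Scope classical_set_scope.

(** Read the intermediate clauses of abstract compilation, which mix program
predicates, the predicates p_f and terms of P, in J together with I^a. Every
step preserves truth: from a valuation of the clause before the step, set the
fresh variable X to the value of f(ts); conversely the added atom p_f(ts, X)
forces X to have that value. The last clause has no function symbols, so its
truth depends on I^a only and not on J. *)

(** * Terms: induction, variables and substitution *)

Lemma term_induction (F : ranked) (p : term F -> Prop) :
  (forall x, p (Var x)) ->
  (forall f (ts : (term F ^ arity f)%type), (forall i, p (ts i)) -> p (App f ts)) ->
  forall t, p t.
Proof.
move=> pVar pApp; fix IH 1 => -[x|f ts]; first exact: pVar.
by apply: pApp => i; apply: IH.
Qed.

Lemma mem_flatten_codom (A : finType) (T : eqType) (s : A -> seq T) (y : T) :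
  reflect (exists i, y \in s i) (y \in flatten (codom s)).
Proof.
apply: (iffP flattenP) => [[_ /codomP[i ->] ys]|[i ys]]; first by exists i.
by exists (s i) => //; apply: codom_f.
Qed.

Lemma vars_subst (F : ranked) (X y : nat) (u t : term F) :
  X \in vars t -> y \in vars u -> y \in vars (subst X u t).
Proof.
move=> + yu; elim/term_induction: t => [x|f ts IH] /=.
  by rewrite inE eq_sym => ->.
case/mem_flatten_codom=> i Xi; apply/mem_flatten_codom; exists i.
by rewrite ffunE IH.
Qed.

(** Serves with [y] equal to [X], to show that a fresh variable does not occur in the term it
    replaces. *)
Lemma clause_vars_subst (R F : ranked) (X y : nat) (u : term F)
    (C : clause R (term F)) :
  X \in clause_vars C -> y \in vars u -> y \in clause_vars (subst_clause X u C).
Proof.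
rewrite /clause_vars; have -> : seq_of_opt (chead (subst_clause X u C)) ++
    cbody (subst_clause X u C) =
    map (map_atom (subst X u)) (seq_of_opt (chead C) ++ cbody C).
  by rewrite map_cat; case: C => -[].
elim: (_ ++ _) => //= a s IH; rewrite !mem_cat => /orP[Xa|Xs] yu; last first.
  by rewrite IH ?orbT.
apply/orP; left; case/mem_flatten_codom: Xa => i Xi.
by apply/mem_flatten_codom; exists i; rewrite ffunE vars_subst.
Qed.

Lemma eq_eval (F : ranked) (D : Type) (J : pre_interpretation F D)
    (v w : nat -> D) (t : term F) :
  {in vars t, v =1 w} -> eval J v t = eval J w t.
Proof.
elim/term_induction: t => [x|f ts IH] /= vw; first by rewrite vw ?inE.
congr (J f _); apply/ffunP => i; rewrite !ffunE; apply: IH => x xi.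
by apply/vw/mem_flatten_codom; exists i.
Qed.

Lemma eval_subst (F : ranked) (D : Type) (J : pre_interpretation F D)
    (v : nat -> D) (X : nat) (u t : term F) :
  eval J v (subst X u t) = eval J [eta v with X |-> eval J v u] t.
Proof.
elim/term_induction: t => [x|f ts IH] /=; first by case: ifP.
by congr (J f _); apply/ffunP => i; rewrite !ffunE.
Qed.

(** * Atoms, and truth of a clause at one valuation *)

Lemma eq_map_atom (R : ranked) (T U : Type) (g h : T -> U) (a : atom R T) :
  g =1 h -> map_atom g a = map_atom h a.
Proof.
by move=> gh; rewrite /map_atom; congr Atom; apply/ffunP => i; rewrite !ffunE.
Qed.

Lemma map_atom_comp (R : ranked) (T U V : Type) (g : U -> V) (h : T -> U)
    (a : atom R T) :
  map_atom g (map_atom h a) = map_atom (g \o h) a.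
Proof.
by rewrite /map_atom; congr Atom; apply/ffunP => i; rewrite !ffunE.
Qed.

Lemma map_graph_atom (R F : ranked) (T U : Type) (g : T -> U) (f : F)
    (ts : (T ^ arity f)%type) (x : T) :
  map_atom g (graph_atom R ts x) = graph_atom R [ffun i => g (ts i)] (g x).
Proof.
rewrite /map_atom /graph_atom /=; congr Atom; apply/ffunP => i.
by rewrite !ffunE; case: unliftP => [j|] _ //=; rewrite ffunE.
Qed.

(** The condition of [clause_holds] at a single valuation. The map [g] is arbitrary, to cover both
    terms ([g] an evaluation) and bare variables ([g] a valuation). *)
Definition true_at (R : ranked) (T D : Type) (I : interpretation R D)
    (g : T -> D) (C : clause R T) : Prop :=
  (forall a, List.In a (cbody C) -> I (map_atom g a)) ->
  if chead C is Some a then I (map_atom g a) else False.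

Lemma true_at_map (R S : ranked) (T U D : Type) (I : interpretation R D)
    (I' : interpretation S D) (g : T -> D) (h : U -> D)
    (k : atom R T -> atom S U) (C : clause R T) :
  (forall a, I' (map_atom h (k a)) <-> I (map_atom g a)) ->
  true_at I' h (map_clause k C) <-> true_at I g C.
Proof.
move=> kP; case: C => H B; rewrite /true_at /=.
have -> : (forall a, List.In a (map k B) -> I' (map_atom h a)) <->
          (forall a, List.In a B -> I (map_atom g a)).
  split=> [HB a aB|HB _ /List.in_map_iff[a [<- aB]]]; last exact/kP/HB.
  by apply/kP/HB/List.in_map.
by case: H => //= a; rewrite kP.
Qed.

Lemma eq_true_at (R : ranked) (T D : Type) (I : interpretation R D)
    (g h : T -> D) (C : clause R T) :
  g =1 h -> true_at I g C -> true_at I h C.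
Proof.
move=> gh; rewrite /true_at => gC Bh.
have {gC}/gC : forall a, List.In a (cbody C) -> I (map_atom g a).
  by move=> a /Bh; rewrite (eq_map_atom _ gh).
by case: (chead C) => // a; rewrite (eq_map_atom _ gh).
Qed.

(** Evaluating a variable involves no functor, so [F] and [J] drop out on the right; this lets one
    pre-interpretation be exchanged for another. *)
Lemma clause_holds_of_vars (R F : ranked) (D : Type)
    (J : pre_interpretation F D) (I : interpretation R D) (C : clause R nat) :
  clause_holds J I (of_vars F C) <-> forall v, true_at I v C.
Proof.
have CP v : true_at I (eval J v) (of_vars F C) <-> true_at I v C.
  by apply: true_at_map => a; rewrite map_atom_comp (@eq_map_atom _ _ _ _ v).
by split=> HC v; apply/CP/HC.
Qed.

(** * Truth in I^a, and its invariance under abstraction steps *)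

Section AbstractInterpretation.

Variables (R F : ranked) (D : Type) (J : pre_interpretation F D).
Variable I : interpretation R D.
Arguments J : clear implicits.

(* Tests the argument tuple instead of asking for [f], [ds] with
   [a = graph_atom R ds (J f ds)]: predicate symbols have no decidable
   equality, so an equality of atoms does not give one of their tuples. *)
Definition graph_of : interpretation (abs_preds R F) D := fun a =>
  match a with
  | Atom (inl _) _ => False
  | Atom (inr f) xs => J f [ffun i => xs (lift ord_max i)] = xs ord_max
  end.

Lemma graph_of_graph_atom (f : F) (ds : (D ^ arity f)%type) (d : D) :
  graph_of (graph_atom R ds d) <-> J f ds = d.
Proof.
rewrite /= ffunE unlift_none /=.
have -> // : [ffun i => snoc ds d (lift ord_max i)] = ds.
by apply/ffunP => i; rewrite !ffunE liftK.
Qed.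

Lemma true_at_fact (M : interpretation (abs_preds R F) D) (v : nat -> D)
    (a : atom (abs_preds R F) D) :
  true_at M (eval (herbrand D) v)
    (Clause (Some (map_atom (@const D) a)) [::]) <-> M a.
Proof.
have aE : map_atom (eval (herbrand D) v) (map_atom (@const D) a) = a.
  case: a => p xs; rewrite /map_atom; congr Atom.
  by apply/ffunP => i; rewrite !ffunE.
by rewrite -{2}aE; split=> [Ma|Ma _]; [apply: Ma|exact: Ma].
Qed.

Lemma model_graph_of : model (herbrand D) graph_of (facts_of R J).
Proof.
move=> _ [f [ds [d [fd ->]]]] v.
by apply/true_at_fact/graph_of_graph_atom.
Qed.

(** The least model is the intersection of all models, and [graph_of] is one of them. *)
Lemma least_herbrand_model_graph_of (a : atom (abs_preds R F) D) :
  least_herbrand_model (facts_of R J) a -> graph_of a.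
Proof. by apply; apply: model_graph_of. Qed.

Lemma abs_interpretation_prog_atom (a : atom R D) :
  abs_interpretation J I (prog_atom F a) <-> I a.
Proof.
split=> [[[b Ib ab]|/least_herbrand_model_graph_of //]|Ia]; last first.
  by left; exists a.
(* A partial inverse yields injectivity of [prog_atom] without inverting an equality of dependent
   records. *)
pose prog_part (c : atom (abs_preds R F) D) : option (atom R D) :=
  match c with
  | Atom (inl p) xs => Some (@Atom R D p xs)
  | Atom (inr _) _ => None
  end.
have progK : pcancel (@prog_atom R F D) prog_part by case.
by rewrite -(pcan_inj progK ab).
Qed.

Lemma abs_interpretation_graph_atom (f : F) (ds : (D ^ arity f)%type) (d : D) :
  abs_interpretation J I (graph_atom R ds d) <-> J f ds = d.
Proof.
split=> [[[b _ /(congr1 (@pred_of _ _))] //|]|fd].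
  by move/least_herbrand_model_graph_of/graph_of_graph_atom.
(* The fact is ground, so any valuation serves; [d] provides a constant one. *)
right=> M MP; apply/(true_at_fact M (fun=> d)).
by apply: MP; exists f, ds, d.
Qed.

Lemma clause_holds_prog_atom (C : clause R (term F)) :
  clause_holds J (abs_interpretation J I)
    (map_clause (@prog_atom R F (term F)) C) <-> clause_holds J I C.
Proof.
have CP v : true_at (abs_interpretation J I) (eval J v)
    (map_clause (@prog_atom R F (term F)) C) <-> true_at I (eval J v) C.
  by apply: true_at_map => a; apply: (abs_interpretation_prog_atom (map_atom _ a)).
by split=> HC v; apply/CP/HC.
Qed.

Lemma true_at_subst (C : clause (abs_preds R F) (term F)) (X : nat)
    (u : term F) (v : nat -> D) :
  true_at (abs_interpretation J I) (eval J v) (subst_clause X u C) <->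
  true_at (abs_interpretation J I) (eval J [eta v with X |-> eval J v u]) C.
Proof.
apply: true_at_map => a; rewrite map_atom_comp.
by rewrite (eq_map_atom _ (eval_subst J v X u)).
Qed.

(** The added atom is true in I^a exactly when [X] has the value of f(ts), so in the body it acts as
    that extra premise. *)
Lemma true_at_rcons_graph_atom (C : clause (abs_preds R F) (term F)) (f : F)
    (ts : (term F ^ arity f)%type) (X : nat) (v : nat -> D) :
  true_at (abs_interpretation J I) (eval J v)
    (Clause (chead C) (rcons (cbody C) (graph_atom R ts (Var X)))) <->
  (eval J v (App f ts) = v X -> true_at (abs_interpretation J I) (eval J v) C).
Proof.
rewrite /true_at -cats1 /=; split=> HC.
  move=> fX HB; apply: HC => a /List.in_app_iff[/HB //|[<-|//]].
  by rewrite map_graph_atom; apply/abs_interpretation_graph_atom.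
move=> HB; apply: HC => [|a aC]; last by apply/HB/List.in_app_iff; left.
apply/abs_interpretation_graph_atom; rewrite -[v X]/(eval J v (Var X)).
by rewrite -map_graph_atom; apply/HB/List.in_app_iff; right; left.
Qed.

Lemma abstract_step_holds (C C' : clause (abs_preds R F) (term F)) :
  abstract_step C C' ->
  clause_holds J (abs_interpretation J I) C <->
  clause_holds J (abs_interpretation J I) C'.
Proof.
case=> C0 X f ts XC XC0 CE.
(* Since [X] occurs in [C0], an occurrence of [X] in f(ts) would survive in [C], against
   freshness. *)
have Xts : X \notin vars (App f ts).
  by apply: contra XC; rewrite CE; apply: clause_vars_subst.
split=> HC v.
  apply/true_at_rcons_graph_atom => fX.
  (* By [fX], the update of [v] at [X] is [v] itself. *)
  have := HC v; rewrite CE => /true_at_subst; rewrite fX; apply: eq_true_at => t.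
  by apply: eq_eval => x _ /=; case: eqP => [->|].
rewrite CE; apply/true_at_subst.
have /true_at_rcons_graph_atom := HC [eta v with X |-> eval J v (App f ts)].
(* The update at [X] does not change the value of f(ts), where [X] does not occur. *)
apply; rewrite [RHS]/= eqxx; apply: eq_eval => x xts /=.
by case: eqP => // xX; rewrite -xX xts in Xts.
Qed.

Lemma abstracts_to_holds (C : clause R (term F))
    (Ca : clause (abs_preds R F) nat) :
  abstracts_to C Ca ->
  clause_holds J I C <->
  clause_holds (herbrand D) (abs_interpretation J I) (of_vars (constants D) Ca).
Proof.
(* The final clause is moved from the Herbrand pre-interpretation to [J], in which all steps can be
   read. *)
move=> CCa; rewrite clause_holds_of_vars -(clause_holds_of_vars J).
rewrite -clause_holds_prog_atom.
elim: CCa => // [C1 C2 /abstract_step_holds //|C1 C2 C3 _ -> _ -> //].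
Qed.

Lemma model_facts_of :
  model (herbrand D) (abs_interpretation J I) (facts_of R J).
Proof.
move=> _ [f [ds [d [fd ->]]]] v.
by apply/true_at_fact/abs_interpretation_graph_atom.
Qed.

End AbstractInterpretation.

(** Substitution never creates or removes a head. Needed because [abs_query] keeps only the body of
    the selected clause. *)
Lemma abstracts_to_chead_None (R F : ranked) (C : clause R (term F))
    (Ca : clause (abs_preds R F) nat) :
  abstracts_to C Ca -> chead C = None -> chead Ca = None.
Proof.
move=> CCa HC; have : chead (of_vars F Ca) = None; last by case: (Ca) => -[].
have : chead (map_clause (@prog_atom R F (term F)) C) = None by rewrite /= HC.
elim: CCa => // [_ _ [C0 X f ts _ _ -> /=]|C1 C2 C3 _ IH1 _ IH2 /IH1/IH2 //].
by case: (chead C0).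
Qed.

Theorem theorem1 (F R : ranked) (P : set (clause R (term F)))
  (HP : definite P) (Q : seq (atom R (term F)))
  (D : Type) (J : pre_interpretation F D) (I : interpretation R D)
  (cl_a : clause R (term F) -> clause (abs_preds R F) nat)
  (Hcl_a : abstract_compilation cl_a) :
  model J I (P `|` [set false_if Q]) <->
  model (herbrand D) (abs_interpretation J I)
    (abs_program D cl_a P `|` facts_of R J `|`
     [set false_if (abs_query D cl_a Q)]).
Proof.
have QE : of_vars (constants D) (cl_a (false_if Q)) =
    false_if (abs_query D cl_a Q).
  have := abstracts_to_chead_None (Hcl_a (false_if Q)) erefl.
  by rewrite /abs_query; case: (cl_a _) => h b /= ->.
(* The two programs are compared clause by clause; the facts of [J] hold in I^a for every [I]. *)
have holdsP C := abstracts_to_holds J I (Hcl_a C).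
split=> M C.
  case=> [[[C' PC' <-]|]|->].
  - by apply/holdsP/M; left.
  - exact: model_facts_of.
  - by rewrite -QE; apply/holdsP/M; right.
case=> [PC|->]; apply/holdsP; last by rewrite QE; apply: M; right.
by apply: M; left; left; exists C.
Qed.
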